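(* Let $G$ be a finite group of odd order that is nilpotent of class $2$, and suppose that the exponent of the commutator subgroup of $G$ is $p_1^{r_1}p_2^{r_2}\cdots p_s^{r_s}$, where $p_1,\ldots,p_s$ are distinct odd primes and $r_1,\ldots,r_s$ are non-negative integers. Then there are at least $r_1+r_2+\cdots+r_s$ pairwise non-isomorphic groups that are nilpotent of class $2$ and each of which has the same order structure as $G$.
   Context: A nilpotent group of class $2$ means a non-abelian group whose commutator subgroup is contained in its center. For a group $G$ of finite order $r$, the order structure of $G$ is the $r$-tuple $(n_1,\ldots,n_r)$ of natural numbers with $1=n_1\le n_2\le\cdots\le n_r$ such that the elements of $G$ can be listed as $x_1,\ldots,x_r$ with the order of $x_i$ equal to $n_i$ for each $i$ (i.e. the nondecreasing list of the orders of all elements of $G$). In particular, groups with the same order structure have the same order. The group $G$ itself may be counted among the groups in the conclusion. *)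

(* Defs.v *)
From mathcomp Require Import all_boot all_fingroup all_solvable.

Set Implicit Arguments.
Unset Strict Implicit.
Unset Printing Implicit Defensive.

Local Open Scope group_scope.

Definition nilpotent_of_class_2 (gT : finGroupType) (G : {group gT}) : bool :=
  ~~ abelian G && ([~: G, G] \subset 'Z(G)).

(* The nondecreasing list, of length #|G|, of the orders of all elements of G;
   its first entry is automatically 1, the order of the identity. *)
Definition order_structure (gT : finGroupType) (G : {group gT}) : seq nat :=
  sort leq [seq #[x] | x in G].

(* Main.v *)
(* In a group of class 2, [x *_t y := x y [x, y]^t] is again a group law of
   class at most 2; it has the same powers, hence the same element orders, and
   its commutators are [x, y]^(2t+1). If 2t+1 divides the (odd) exponent e of
   the commutator subgroup, the new commutator subgroup has exponent e/(2t+1),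
   so distinct proper divisors of e give non-isomorphic non-abelian groups. The
   products of proper final segments of a prime factorization of e give as many
   proper divisors as there are prime factors, counted with multiplicity. *)

Require Import Defs.
From HB Require Import structures.
From mathcomp Require Import all_boot all_fingroup all_solvable.

Set Implicit Arguments.
Unset Strict Implicit.
Unset Printing Implicit Defensive.

(** Induction on [s]: the product [P] of the tail joins the divisors obtained for the tail. Those
    are all less than [P], so injectivity persists, and [P] is proper because [a] is at least 2. *)
Lemma proper_divisor_family (s : seq nat) :
  all (leq 2) s ->
  exists2 c : 'I_(size s) -> nat, injective c
    & forall k, c k %| \prod_(x <- s) x /\ c k < \prod_(x <- s) x.
Proof.
elim: s => [_ | a s IH /= /andP[a1 s1]]; first by exists (fun=> 0) => [] [].
have [c injc cP] := IH s1; rewrite big_cons; set P := \prod_(x <- s) x in cP *.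
have P0 : 0 < P.
  by rewrite /P big_seq prodn_cond_gt0 // => x /(allP s1)/ltnW.
have ltP : P < a * P by rewrite -[X in X < _]mul1n ltn_pmul2r.
(* The last index receives the default [P]; the others come from the induction. *)
exists (fun k : 'I_(size s).+1 => oapp c P (unlift ord_max k)).
  move=> k l; case: unliftP => [k'|] ->; case: unliftP => [l'|] -> //=.
  - by move/injc->.
  - by move=> eqP; have [_] := cP k'; rewrite eqP ltnn.
  - by move=> eqP; have [_] := cP l'; rewrite -eqP ltnn.
move=> k; case: unliftP => [k'|] _ /=; last by rewrite dvdn_mull.
have [dv lt] := cP k'.
by rewrite dvdn_mull //; split=> //; apply: ltn_trans lt ltP.
Qed.

Local Open Scope group_scope.

Definition central_comm (gT : finGroupType) : Prop :=
  forall x y z : gT, commute [~ x, y] z.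

(* A copy of [gT]: the parameters only select its deformed group law. *)
Definition twist (gT : finGroupType) (t : nat) (cG : central_comm gT) : Type :=
  gT.

HB.instance Definition _ (gT : finGroupType) t (cG : central_comm gT) :=
  Finite.on (twist t cG).

Section Twist.
Variables (gT : finGroupType) (t : nat).
Hypothesis cG : central_comm gT.
Implicit Types x y z : gT.

Let mul x y := x * y * [~ x, y] ^+ t.

Lemma commMg_central x y z : [~ x * y, z] = [~ x, z] * [~ y, z].
Proof. by rewrite commMgJ conjgE (cG x z y) mulKg. Qed.

Lemma commgM_central x y z : [~ x, y * z] = [~ x, y] * [~ x, z].
Proof. by rewrite commgMJ conjgE (cG x y z) mulKg (cG x z). Qed.

Lemma commute_commX x y z n : commute ([~ x, y] ^+ n) z.
Proof. exact/commute_sym/commuteX/commute_sym. Qed.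

Lemma commgX_central x y z n : [~ x, [~ y, z] ^+ n] = 1.
Proof. by apply/eqP/commgP/commute_sym/commute_commX. Qed.

Lemma commXg_central x y z n : [~ [~ x, y] ^+ n, z] = 1.
Proof. exact/eqP/commgP/commute_commX. Qed.

(** Central commutators are multiplicative in each argument, so both bracketings expand to
    [x * y * z] times the [t]-th powers of [[~ x, y]], [[~ x, z]] and [[~ y, z]]. *)
Lemma twist_mulA : associative mul.
Proof.
move=> x y z; rewrite /mul.
rewrite !commgM_central !commMg_central commgX_central commXg_central !mulg1.
rewrite (expgMn t (cG x y _)) (expgMn t (cG x z _)).
rewrite -(mulgA (x * y)) (commute_commX x y z t) -!mulgA; do 3!congr (_ * _).
by rewrite (commute_commX y z) -mulgA.
Qed.

Lemma twist_mul1 : left_id 1 mul.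
Proof. by move=> x; rewrite /mul mul1g comm1g expg1n mulg1. Qed.

Lemma twist_mulV : left_inverse 1 (fun x => x^-1) mul.
Proof.
move=> x; rewrite /mul mulVg mul1g.
have /commgP/eqP-> : commute x^-1 x by exact/commute_sym/commuteV.
exact: expg1n.
Qed.

(** This identifies the commutator of the new law. Its exponent is 1 from [x * y = y * x *
    [~ x, y]], [t] from the correction of [x * y], and [t] from cancelling [[~ y, x] ^+ t]. *)
Lemma twist_mul_comm x y :
  mul (mul y x) ([~ x, y] ^+ t.*2.+1) = mul x y.
Proof.
rewrite /mul commgX_central // expg1n mulg1 (commgC x y) -!(mulgA (y * x)).
congr (_ * _); rewrite -[[~ y, x]]invg_comm expgVn.
by apply: (canLR (mulKg _)); rewrite -expgS -expgD addnS addnn.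
Qed.
End Twist.

HB.instance Definition _ (gT : finGroupType) t (cG : central_comm gT) :=
  Finite_isGroup.Build (twist t cG) (twist_mulA t cG) (twist_mul1 t)
    (@twist_mulV gT t).

Section TwistTheory.
Variables (gT : finGroupType) (t : nat).
Hypothesis cG : central_comm gT.
Notation tT := (twist t cG).

Lemma twistME (x y : tT) :
  x * y = ((x : gT) * (y : gT) * [~ (x : gT), (y : gT)] ^+ t) :> gT.
Proof. by []. Qed.

(** An element commutes with its powers, so the correction factor is trivial. *)
Lemma twistXE (x : tT) n : x ^+ n = ((x : gT) ^+ n) :> gT.
Proof.
elim: n => [|n IHn]; first by [].
rewrite !expgS twistME IHn.
have /commgP/eqP-> : commute (x : gT) ((x : gT) ^+ n) by exact: commuteX.
by rewrite expg1n mulg1.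
Qed.

Lemma twist_order (x : tT) : #[x] = #[x : gT].
Proof.
apply/eqP; rewrite eqn_dvd; apply/andP; split.
  by rewrite order_dvdn; apply/eqP; rewrite twistXE expg_order.
by rewrite order_dvdn -(twistXE x) (expg_order x).
Qed.

Lemma twist_comm (x y : tT) :
  [~ x, y] = [~ (x : gT), (y : gT)] ^+ t.*2.+1 :> gT.
Proof.
apply: (@mulgI tT (y * x)); rewrite -commgC.
exact: etrans (twistME _ _) (esym (twist_mul_comm t cG x y)).
Qed.

Lemma twist_central_comm : central_comm tT.
Proof.
(* The two types are convertible, so the equation can be read in [gT]. *)
move=> x y z; apply: (_ : _ = _ :> gT).
rewrite !twistME twist_comm commXg_central // commgX_central // expg1n !mulg1.
exact: commute_commX.
Qed.
End TwistTheory.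

(** The commutator subgroup is abelian here, so its exponent can be tested on the generating
    commutators. *)
Lemma exponent_der1_dvdn (gT : finGroupType) (G : {group gT}) n :
  [~: G, G] \subset 'Z(G) ->
  reflect {in G &, forall x y, [~ x, y] ^+ n = 1} (exponent [~: G, G] %| n).
Proof.
move=> cG; have abG' := abelianS cG (center_abelian G).
rewrite abelian_exponent_gen; last by rewrite -abelian_gen.
apply: (iffP exponentP) => [h x y Gx Gy | h _ /imset2P[x y Gx Gy ->]].
  by apply: h; rewrite imset2_f.
exact: h.
Qed.

Lemma central_comm_der1 (gT : finGroupType) :
  central_comm gT -> [~: [set: gT], [set: gT]] \subset 'Z([set: gT]).
Proof.
move=> cG; rewrite gen_subG; apply/subsetP=> _ /imset2P[x y _ _ ->].
by apply/centerP; split=> [|z _]; [rewrite inE | apply: cG].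
Qed.

Lemma exponent_twist_der1 (gT : finGroupType) t (cG : central_comm gT) :
  t.*2.+1 %| exponent [~: [set: gT], [set: gT]] ->
  exponent [~: [set: twist t cG], [set: twist t cG]]
    = (exponent [~: [set: gT], [set: gT]] %/ t.*2.+1)%N.
Proof.
move=> dv; apply/eqP; rewrite eqn_dvd; apply/andP; split.
  apply/exponent_der1_dvdn; first exact/central_comm_der1/twist_central_comm.
  move=> x y _ _; apply: (_ : _ = _ :> gT).
  rewrite twistXE twist_comm -expgM mulnC divnK //.
  have /exponent_der1_dvdn H := dvdnn (exponent [~: [set: gT], [set: gT]]).
  by apply: H; rewrite ?inE //; apply: central_comm_der1.
(* Multiplying by [t.*2.+1] removes the quotient; a power of a commutator to this multiple is a
   power of a twisted commutator. *)
rewrite -(@dvdn_pmul2r t.*2.+1) // divnK //.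
apply/exponent_der1_dvdn; first exact: central_comm_der1.
move=> x y _ _; rewrite mulnC expgM -(twist_comm (x : twist t cG) y) -twistXE.
have /exponent_der1_dvdn H :=
  dvdnn (exponent [~: [set: twist t cG], [set: twist t cG]]).
by apply: H; rewrite ?inE //; apply/central_comm_der1/twist_central_comm.
Qed.

Lemma isog_exponent_der1 (gT hT : finGroupType)
    (G : {group gT}) (H : {group hT}) :
  G \isog H -> exponent [~: G, G] = exponent [~: H, H].
Proof.
case/isogP=> f injf <-.
by rewrite -morphimR // exponent_injm // (der_sub 1 G).
Qed.

(** The twist deforms a whole type, so [G] is replaced by the type of its elements. *)
Lemma subg_central_comm (gT : finGroupType) (G : {group gT}) :
  [~: G, G] \subset 'Z(G) -> central_comm (subg_of G).
Proof.
move=> cG x y z; apply: val_inj => /=.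
have /centerP[_] : [~ val x, val y] \in 'Z(G).
  by rewrite (subsetP cG) // mem_commg // subgP.
by move/(_ (val z) (subgP z)).
Qed.

Lemma order_structure_twist (gT : finGroupType) (G : {group gT}) t
    (cG : central_comm (subg_of G)) :
  order_structure [set: twist t cG] = order_structure G.
Proof.
apply/perm_sortP; [exact: leq_total | exact: leq_trans | exact: anti_leq |].
rewrite /image_mem.
rewrite (eq_map (g := (fun x => #[x]) \o (val : twist t cG -> gT))); last first.
  by move=> x /=; rewrite twist_order -(order_injm (injm_sgval G)) ?inE.
rewrite map_comp; apply: perm_map; apply: uniq_perm; rewrite ?enum_uniq //.
  by rewrite map_inj_uniq ?enum_uniq //; apply: val_inj.
move=> x; rewrite mem_enum; apply/mapP/idP=> [[y _ ->] | Gx].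
  exact: subgP.
by exists (subg G x); rewrite ?mem_enum ?inE //= subgK.
Qed.

Theorem corollary3p1 (gT : finGroupType) (G : {group gT})
    (s : nat) (p r : 'I_s -> nat)
    (oddG : odd #|G|) (nil2G : nilpotent_of_class_2 G)
    (p_inj : injective p)
    (p_prime : forall i : 'I_s, prime (p i))
    (p_odd : forall i : 'I_s, odd (p i))
    (expG' : exponent [~: G, G] = (\prod_(i < s) p i ^ r i)%N) :
  exists (hT : 'I_(\sum_(i < s) r i) -> finGroupType)
         (H : forall k, {group hT k}),
    [/\ forall k, nilpotent_of_class_2 (H k),
        forall k, order_structure (H k) = order_structure G
      & forall k l, k != l -> ~~ (H k \isog H l)].
Proof.
have /andP[_ cG] := nil2G; have cgG := subg_central_comm cG.
set e := exponent _ in expG'.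
have eS : exponent [~: [set: subg_of G], [set: subg_of G]] = e.
  exact/esym/isog_exponent_der1/isog_subg.
(* The primes dividing [e], listed with multiplicity. *)
pose ps := flatten [seq nseq (r i) (p i) | i <- index_enum 'I_s].
have size_ps : size ps = \sum_(i < s) r i.
  rewrite size_flatten sumnE /shape !big_map.
  by apply: eq_bigr => i _; rewrite size_nseq.
have prod_ps : (\prod_(x <- ps) x)%N = e.
  rewrite big_flatten big_map expG'.
  by apply: eq_bigr => i _; rewrite big_nseq iter_muln_1.
have ps_gt1 : all (leq 2) ps.
  apply/allP=> x /flattenP[_ /mapP[i _ ->]] /nseqP[-> _].
  exact: prime_gt1.
have [] := proper_divisor_family ps_gt1.
rewrite size_ps prod_ps => c injc cP.
have odde : odd e.
  apply: dvdn_odd oddG; apply: dvdn_trans (exponent_dvdn _) (cardSg _).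
  exact: (der_sub 1 G).
(* Since [c k] is odd, the parameter [t = (c k)./2] satisfies [2t + 1 = c k]. *)
have oddc k : (c k)./2.*2.+1 = c k.
  have [dv _] := cP k.
  by rewrite -[RHS]odd_double_half (dvdn_odd dv odde).
pose H k := [set: twist (c k)./2 cgG]%G.
have expH k : exponent [~: H k, H k] = (e %/ c k)%N.
  by rewrite exponent_twist_der1 eS oddc //; case: (cP k).
exists (fun k => twist (c k)./2 cgG), H; split=> [k | k | k l neq_kl].
- apply/andP; split; last exact/central_comm_der1/twist_central_comm.
  (* If [H k] were abelian, the exponent [e %/ c k] would be 1, against [c k < e]. *)
  apply/negP => /commG1P abH; have [dv ltce] := cP k.
  have := expH k; rewrite abH exponent1 => /(congr1 (muln^~ (c k))).
  by rewrite divnK // mul1n => E; rewrite E ltnn in ltce.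
- exact: order_structure_twist.
apply: contraNN neq_kl => /isog_exponent_der1; rewrite !expH => E.
have [[dvk _] [dvl _]] := (cP k, cP l).
(* Times their common positive quotient, [c k] and [c l] both give [e], hence they agree. *)
apply/eqP/injc/eqP; rewrite -(eqn_pmul2l (m := e %/ c k)).
  by rewrite {2}E !divnK.
have e0 : 0 < e by exact: odd_gt0.
by rewrite divn_gt0 ?(dvdn_gt0 e0 dvk) // dvdn_leq.
Qed.
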